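(* Let $G=(V,E,w)$ be a connected weighted undirected graph with $V=\{1,\dots,n\}$ and weighted Laplacian matrix $L_E$, and let $e\in V\times V\setminus E$ be an edge with given weight $w_e$ and associated weighted incidence vector $m_e\in\mathbb{R}^n$. Let $L_{E\cup\{e\}}=L_E+m_em_e^T$ be the weighted Laplacian of the graph with edge $e$ added. Then $$L_{E\cup\{e\}}^\dagger = (L_E+m_em_e^T)^\dagger = L_E^\dagger-\frac{1}{\beta}L_E^\dagger m_em_e^TL_E^\dagger,\qquad \beta = 1+m_e^TL_E^\dagger m_e,$$ and correspondingly $$\mathrm{trace}\left(L_{E\cup\{e\}}^\dagger\right)=\mathrm{trace}\left(L_E^\dagger\right)-\frac{1}{\beta}\left\|L_E^\dagger m_e\right\|^2.$$
   Context: Edges are undirected and join two distinct nodes. Every edge has a nonnegative real weight. For an edge $e=(i,j)$ with $i>j$ and weight $w_e$, the weighted incidence vector $m_e\in\mathbb{R}^n$ has entries $(m_e)_i=w_e$, $(m_e)_j=-w_e$, and all other entries $0$. The weighted Laplacian associated with the edge set $E$ is $L_E=\sum_{e\in E} m_e m_e^T$. ''Connected weighted graph'' means connected through edges of nonzero weight, so that $L_E$ has rank $n-1$. $X^\dagger$ denotes the Moore-Penrose pseudoinverse of $X$, and $\|\cdot\|$ is the Euclidean norm. *)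

(* Defs.v *)
From mathcomp Require Import all_boot all_order all_algebra.
From mathcomp Require Import reals.

Set Implicit Arguments.
Unset Strict Implicit.
Unset Printing Implicit Defensive.

Import Order.TTheory GRing.Theory Num.Theory.

Local Open Scope ring_scope.

(* The four Penrose equations: X is the Moore-Penrose pseudoinverse of A.
   This is unrelated to MathComp's [pinvmx], which only satisfies the first. *)
Definition moore_penrose (R : realType) (m n : nat) (A : 'M[R]_(m, n))
    : pred 'M[R]_(n, m) :=
  fun X => [&& A *m X *m A == A,
               X *m A *m X == X,
               (A *m X)^T == A *m X &
               (X *m A)^T == X *m A].

Lemma trmx_mul_eq0 (R : realType) (n : nat) (v : 'rV[R]_n) :
  v *m v^T = 0 -> v = 0.
Proof.
move=> /matrixP/(_ 0 0); rewrite !mxE.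
under eq_bigr do rewrite mxE -expr2.
move/psumr_eq0P => H; apply/rowP => j; rewrite !mxE; apply/eqP.
by rewrite -sqrf_eq0; apply/eqP/H => // i _; apply: sqr_ge0.
Qed.

Lemma gram_unit (R : realType) (r n : nat) (B : 'M[R]_(r, n)) :
  row_free B -> B *m B^T \in unitmx.
Proof.
move=> fB; rewrite -row_free_unit; apply: inj_row_free => v vBB0.
apply: (row_free_inj fB); rewrite mul0mx; apply: trmx_mul_eq0.
by rewrite trmx_mul !mulmxA -(mulmxA v) vBB0 mul0mx.
Qed.

Lemma moore_penrose_exists (R : realType) (m n : nat) (A : 'M[R]_(m, n)) :
  exists X, moore_penrose A X.
Proof.
have := (col_base_full A, row_base_free A, mulmx_base A).
move: (\rank A) (col_base A) (row_base A) => r C F [[fC fF] AE].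
have uF : F *m F^T \in unitmx by exact: gram_unit.
have uC : C^T *m C \in unitmx.
  rewrite -{2}[C]trmxK; apply: gram_unit.
  by rewrite /row_free mxrank_tr.
pose P := invmx (F *m F^T); pose Q := invmx (C^T *m C).
have sP : P^T = P by rewrite trmx_inv trmx_mul trmxK.
have sQ : Q^T = Q by rewrite trmx_inv trmx_mul trmxK.
pose X := F^T *m P *m Q *m C^T.
have AX : A *m X = C *m Q *m C^T.
  by rewrite -AE /X !mulmxA -(mulmxA C F) -(mulmxA C (F *m _)) mulmxV // mulmx1.
have XA : X *m A = F^T *m P *m F.
  rewrite -AE /X !mulmxA -(mulmxA _ C^T C) -(mulmxA _ Q (_ *m C)).
  by rewrite mulVmx // mulmx1.
exists X; apply/and4P; split; apply/eqP.
- by rewrite AX -AE !mulmxA -(mulmxA _ C^T C) -(mulmxA _ Q (_ *m C))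
       mulVmx // mulmx1.
- by rewrite XA /X !mulmxA -(mulmxA _ F F^T) -(mulmxA _ P (F *m _))
       mulVmx // mulmx1.
- by rewrite AX !trmx_mul sQ trmxK mulmxA.
- by rewrite XA !trmx_mul sP trmxK mulmxA.
Qed.

Definition mpinv (R : realType) (m n : nat) (A : 'M[R]_(m, n)) : 'M[R]_(n, m) :=
  xchoose (moore_penrose_exists A).

Lemma mpinvP (R : realType) (m n : nat) (A : 'M[R]_(m, n)) :
  moore_penrose A (mpinv A).
Proof. exact: xchooseP. Qed.

Lemma moore_penrose_unique (R : realType) (m n : nat) (A : 'M[R]_(m, n)) X Y :
  moore_penrose A X -> moore_penrose A Y -> X = Y.
Proof.
case/and4P => /eqP x1 /eqP x2 /eqP x3 /eqP x4.
case/and4P => /eqP y1 /eqP y2 /eqP y3 /eqP y4.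
have AXY : A *m X = A *m Y.
  rewrite -x3 -{1}y1 -[_ *m A *m X]mulmxA trmx_mul x3 y3.
  by rewrite mulmxA x1.
have XAYA : X *m A = Y *m A.
  rewrite -x4 -{1}y1 -[A *m Y *m A]mulmxA mulmxA trmx_mul x4 y4.
  by rewrite -mulmxA (mulmxA A) x1.
by rewrite -x2 XAYA -mulmxA AXY mulmxA y2.
Qed.

Definition norm2 (R : realType) (n : nat) (x : 'cV[R]_n) : R :=
  Num.sqrt (\sum_i x i 0 ^+ 2).

(* An undirected edge between distinct nodes {i, j} is encoded by the unique
   pair (i, j) with i > j; nodes are 0, ..., n-1. *)
Definition edge (n : nat) := {e : 'I_n * 'I_n | (e.2 < e.1)%N}.

Definition incidence (R : realType) (n : nat) (w : edge n -> R) (e : edge n)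
    : 'cV[R]_n :=
  \col_k (if k == (val e).1 then w e
          else if k == (val e).2 then - w e
          else 0).

(* The incidence vectors carry w, so an edge enters with coefficient w^2. *)
Definition laplacian (R : realType) (n : nat) (w : edge n -> R)
    (E : {set edge n}) : 'M[R]_n :=
  \sum_(e in E) incidence w e *m (incidence w e)^T.

Definition adjacent (R : realType) (n : nat) (w : edge n -> R)
    (E : {set edge n}) : rel 'I_n :=
  fun i j => [exists e in E,
    (w e != 0) && ((val e == (i, j)) || (val e == (j, i)))].

Definition connected_wgraph (R : realType) (n : nat) (w : edge n -> R)
    (E : {set edge n}) : Prop :=
  forall i j : 'I_n, connect (adjacent w E) i j.

(* Main.v *)
Require Import Defs.
From mathcomp Require Import all_boot all_order all_algebra.
From mathcomp Require Import reals.

Import Order.TTheory GRing.Theory Num.Theory.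

Local Open Scope ring_scope.

(** Connectedness makes the kernel of L consist of the constant vectors, and
    [1 - L L^+] maps into that kernel.  Since m sums to zero, it is orthogonal
    to the kernel, so [L L^+ m = m].  With [u = L^+ m] this gives
    [(L + m m^T) (L^+ - beta^-1 u u^T) = L L^+], from which the four Penrose
    equations follow; [beta >= 1] because [L^+ = L^+ L L^+] is positive
    semidefinite. *)

Section MoorePenrose.

Context {R : realType} {n : nat}.
Implicit Types (A X : 'M[R]_n) (x u m : 'cV[R]_n).

(** Transposition preserves the first two Penrose equations of a symmetric [A] and swaps the last
    two, so [X^T] is again a pseudoinverse of [A] and uniqueness applies. *)
Lemma mpinv_sym A : A^T = A -> (mpinv A)^T = mpinv A.
Proof.
move=> sA; apply: (@moore_penrose_unique _ _ _ A); last exact: mpinvP.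
have := mpinvP A; move: (mpinv A) => X /and4P[/eqP p1 /eqP p2 /eqP p3 /eqP p4].
have AXt : A *m X^T = X *m A by rewrite -p4 trmx_mul sA.
have XtA : X^T *m A = A *m X by rewrite -p3 trmx_mul sA.
apply/and4P; split; apply/eqP.
- by rewrite -[RHS]sA -[in RHS]p1 !trmx_mul sA mulmxA.
- by rewrite -[in RHS]p2 !trmx_mul sA mulmxA.
- by rewrite AXt p4.
- by rewrite XtA p3.
Qed.

Lemma mpinv_comm A : A^T = A -> A *m mpinv A = mpinv A *m A.
Proof.
move=> sA; have /and4P[_ _ /eqP p3 _] := mpinvP A.
by rewrite -p3 trmx_mul mpinv_sym // sA.
Qed.

(** Since [X = X A X] with [X] symmetric, the form of [X] at [x] is the form of [A] at [X x]. *)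
Lemma mpinv_form_ge0 A x :
    A^T = A -> (forall y : 'cV_n, 0 <= (y^T *m A *m y) 0 0) ->
  0 <= (x^T *m mpinv A *m x) 0 0.
Proof.
move=> sA A_ge0; have /and4P[_ /eqP p2 _ _] := mpinvP A.
have := A_ge0 (mpinv A *m x).
by rewrite trmx_mul mpinv_sym // !mulmxA -(mulmxA _ _ A)
           -(mulmxA _ _ (mpinv A)) p2.
Qed.

(** A Sherman-Morrison formula for pseudoinverses. The condition [A *m mpinv A *m m = m] says that
    [m] lies in the range of [A], so the update leaves the projector [A *m mpinv A] unchanged. *)
Lemma mpinv_rank1_update A m :
    let beta := 1 + (m^T *m mpinv A *m m) 0 0 in
    A^T = A -> A *m mpinv A *m m = m -> beta != 0 ->
  mpinv (A + m *m m^T)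
    = mpinv A - beta^-1 *: (mpinv A *m m *m m^T *m mpinv A).
Proof.
move=> beta sA; have /and4P[/eqP p1 /eqP p2 _ _] := mpinvP A.
have sX := mpinv_sym _ sA; have AX := mpinv_comm _ sA.
rewrite /beta; move: (mpinv A) p1 p2 sX AX => X p1 p2 sX AX AXm beta_neq0.
move uE: (X *m m) => u.
have uT : u^T = m^T *m X by rewrite -uE trmx_mul sX.
have Au : A *m u = m by rewrite -uE mulmxA.
have muE : m^T *m u = ((m^T *m X *m m) 0 0)%:M.
  by rewrite -mx11_scalar -uE mulmxA.
move: (_ 0 0) beta_neq0 muE => b beta_neq0 muE.
rewrite -(mulmxA u) -uT.
pose Y := X - (1 + b)^-1 *: (u *m u^T).
have sB : (A + m *m m^T)^T = A + m *m m^T.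
  by rewrite linearD /= trmx_mul trmxK sA.
have sY : Y^T = Y by rewrite linearB linearZ /= trmx_mul trmxK sX.
have BY : (A + m *m m^T) *m Y = A *m X.
  (* With [A u = m] and [m^T u = b], the product is [A X + m u^T - (1 + b)^-1 (1 + b) m u^T]. *)
  rewrite mulmxDl !mulmxBr -!scalemxAr !mulmxA Au -(mulmxA m m^T u) muE.
  rewrite mul_mx_scalar -scalemxAl scalerA -(mulmxA m m^T X) -uT.
  rewrite -addrA [- _ + _]addrCA -opprD -scalerDl -{1}[_^-1]mulr1 -mulrDr.
  by rewrite mulVf // scale1r subrr addr0.
have YB : Y *m (A + m *m m^T) = A *m X.
  (* Transpose of [BY]: both factors are symmetric, and so is [A X], because [A] and [X] commute. *)
  by rewrite -[LHS]trmxK trmx_mul sB sY BY trmx_mul sX sA AX.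
apply: (@moore_penrose_unique _ _ _ (A + m *m m^T)); first exact: mpinvP.
rewrite -/Y; apply/and4P; split; apply/eqP.
- by rewrite BY mulmxDr p1 mulmxA AXm.
- by rewrite YB AX mulmxBr p2 -scalemxAr mulmxA -(mulmxA X A) Au uE.
- by rewrite BY trmx_mul sX sA AX.
- by rewrite YB trmx_mul sX sA AX.
Qed.

Lemma norm2_sqr u : norm2 u ^+ 2 = \tr (u *m u^T).
Proof.
rewrite sqr_sqrtr; last by apply: sumr_ge0 => i _; exact: sqr_ge0.
by apply: eq_bigr => i _; rewrite mxE big_ord1 !mxE expr2.
Qed.

End MoorePenrose.

Section Laplacian.

Context {R : realType} {n : nat} (w : edge n -> R).
Implicit Types (E : {set edge n}) (e : edge n) (x : 'cV[R]_n).

Lemma incidence_form e x :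
  ((incidence w e)^T *m x) 0 0 = w e * (x (val e).1 0 - x (val e).2 0).
Proof.
have ne : (val e).2 != (val e).1.
  by apply/eqP=> eq; have := valP e; rewrite eq ltnn.
rewrite mxE (bigD1 (val e).1) //= (bigD1 (val e).2) //= big1.
  by rewrite !mxE !eqxx (negPf ne) addr0 mulrBr mulNr.
by move=> i /andP[i1 i2]; rewrite !mxE (negPf i1) (negPf i2) mul0r.
Qed.

Lemma laplacian_sym E : (laplacian w E)^T = laplacian w E.
Proof.
by rewrite linear_sum; apply: eq_bigr => e _ /=; rewrite trmx_mul trmxK.
Qed.

Lemma laplacian_form E x :
  (x^T *m laplacian w E *m x) 0 0
    = \sum_(e in E) (((incidence w e)^T *m x) 0 0) ^+ 2.
Proof.
rewrite mulmx_sumr mulmx_suml summxE; apply: eq_bigr => e _.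
rewrite mulmxA -mulmxA mxE big_ord1 expr2; congr (_ * _).
(* A 1 by 1 matrix equals its transpose. *)
by rewrite -[x^T *m _]trmxK mxE trmx_mul trmxK.
Qed.

Lemma laplacian_form_ge0 E x : 0 <= (x^T *m laplacian w E *m x) 0 0.
Proof. by rewrite laplacian_form sumr_ge0 // => e _; exact: sqr_ge0. Qed.

(** The form of the Laplacian at [x] is a sum of squares, so each term vanishes. Hence [x] agrees at
    the ends of every edge of nonzero weight, and by induction along paths. *)
Lemma laplacian_ker E x :
  connected_wgraph w E -> laplacian w E *m x = 0 -> forall i j, x i 0 = x j 0.
Proof.
move=> E_conn Lx0 i j.
have : (x^T *m laplacian w E *m x) 0 0 = 0 by rewrite -mulmxA Lx0 mulmx0 mxE.
rewrite laplacian_form => /psumr_eq0P form0.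
have adj_eq k l : adjacent w E k l -> x k 0 = x l 0.
  case/exists_inP=> e eE /andP[we_neq0 /orP ekl].
  have /eqP := form0 (fun e _ => sqr_ge0 _) e eE.
  rewrite sqrf_eq0 incidence_form mulf_eq0 (negPf we_neq0) subr_eq0 /=.
  by case: ekl => /eqP-> /eqP.
have /connectP[p] := E_conn i j.
elim: p i => [|k p IHp] i /=; first by move=> _ ->.
by case/andP=> /adj_eq-> /IHp; apply.
Qed.

Lemma laplacian_range E e :
    connected_wgraph w E ->
  laplacian w E *m mpinv (laplacian w E) *m incidence w e = incidence w e.
Proof.
move=> E_conn; have sL := laplacian_sym E; have comm := mpinv_comm _ sL.
have /and4P[/eqP p1 _ /eqP p3 _] := mpinvP (laplacian w E).
pose P := 1%:M - laplacian w E *m mpinv (laplacian w E).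
have LP : laplacian w E *m P = 0 by rewrite mulmxBr mulmx1 comm mulmxA p1 subrr.
have mP : (incidence w e)^T *m P = 0.
  apply/matrixP=> i j; rewrite ord1 [RHS]mxE.
  transitivity (((incidence w e)^T *m col j P) 0 0).
    by rewrite colE mulmxA -colE [RHS]mxE.
  (* Each column of [P] lies in the kernel, hence is constant, and the difference across [e] is
     zero. *)
  rewrite incidence_form (@laplacian_ker E (col j P) E_conn _ _ (val e).2).
    by rewrite subrr mulr0.
  by rewrite colE mulmxA LP mul0mx.
apply/esym/eqP; rewrite -subr_eq0 -{1}[incidence w e]mul1mx -mulmxBl -/P.
(* [P] is symmetric by the third Penrose equation, so [P m] is the transpose of [m^T P]. *)
rewrite -[_ *m _]trmxK trmx_mul [P^T](_ : _ = P) ?mP ?trmx0 //.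
by rewrite linearB /= trmx1 p3.
Qed.

End Laplacian.

Theorem lemma1 (R : realType) (n : nat) (E : {set edge n}) (w : edge n -> R)
    (e : edge n)
    (w_ge0 : forall f : edge n, f \in E -> 0 <= w f)
    (we_ge0 : 0 <= w e)
    (E_connected : connected_wgraph w E)
    (e_notin_E : e \notin E) :
  let L := laplacian w E in
  let L' := laplacian w (e |: E) in
  let m := incidence w e in
  let beta := 1 + (m^T *m mpinv L *m m) 0 0 in
  [/\ L' = L + m *m m^T,
      mpinv L' = mpinv (L + m *m m^T),
      mpinv (L + m *m m^T)
        = mpinv L - beta^-1 *: (mpinv L *m m *m m^T *m mpinv L) &
      \tr (mpinv L') = \tr (mpinv L) - beta^-1 * norm2 (mpinv L *m m) ^+ 2].
Proof.
move=> L L' m beta.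
have sL : L^T = L := laplacian_sym w E.
have L'E : L' = L + m *m m^T by rewrite /L' /laplacian big_setU1 //= addrC.
have beta_neq0 : beta != 0.
  rewrite gt_eqF // ltr_pwDl // mpinv_form_ge0 // => x.
  exact: laplacian_form_ge0.
have range := laplacian_range w E e E_connected.
have update := mpinv_rank1_update _ _ sL range beta_neq0.
split=> //; first by rewrite L'E.
(* The squared norm is the trace of [u u^T] for [u = mpinv L *m m], and symmetry of [mpinv L] turns
   [u^T] into [m^T *m mpinv L]. *)
rewrite L'E update linearB linearZ /= norm2_sqr.
by rewrite trmx_mul (mpinv_sym _ sL) !mulmxA.
Qed.
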